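(* Let $X$ and $Y$ be Banach spaces and assume that there is a weakly sequentially continuous map $f:X\to Y$ which is coarse and satisfies Property $( * )$. Then there exists $c>0$ such that, whenever $(e_n)_n$ is the spreading model, in a Banach space $(S,\|\cdot\|_S)$, of a normalized weakly null sequence in $X$, one has \[c\,\|e_1+\ldots+e_k\|_{\overline{\delta}_Y}\leq\|e_1+\ldots+e_k\|_S\] for all $k\in\mathbb{N}$.
   Context: Maps. For a map $f:X\to Y$ between Banach spaces (not assumed linear) let $\omega_f(t)=\sup\{\|f(x)-f(y)\| : \|x-y\|\le t\}$ for $t\ge 0$. The map $f$ is coarse if $\omega_f(t)<\infty$ for all $t\ge 0$. It satisfies Property $( * )$ if there exist $\beta>\alpha>0$ such that $\inf_{\|x-y\|\in[\alpha,\beta]}\|f(x)-f(y)\|>0$. It is weakly sequentially continuous if $x_n\to x$ weakly in $X$ implies $f(x_n)\to f(x)$ weakly in $Y$. Modulus of asymptotic uniform convexity. For a Banach space $Y$ and $t\ge 0$, \[\overline{\delta}_Y(t)=\inf_{x\in\partial B_Y}\ \sup_{E\in\mathrm{cof}(Y)}\ \inf_{y\in\partial B_E}\|x+ty\|-1,\] where $\partial B$ denotes the unit sphere and $\mathrm{cof}(Y)$ is the set of closed finite-codimensional subspaces of $Y$. On the left side of the inequality, the notation means \[\|e_1+\ldots+e_k\|_{\overline{\delta}_Y}:=\inf\{\lambda>0 : k\cdot\overline{\delta}_Y(\lambda^{-1})\le 1\}\] (here $e_1,\dots,e_k$ are formal unit vectors, unrelated to the spreading model). Spreading models. Let $(x_n)_n$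 be a bounded sequence without Cauchy subsequences in a Banach space $(X,\|\cdot\|)$. A sequence $(e_n)_n$ in a Banach space $(S,\|\cdot\|_S)$ is the spreading model of $(x_n)_n$ if for all $\varepsilon>0$ and $k\in\mathbb{N}$ there is $\ell\in\mathbb{N}$ such that $\big|\,\|\sum_{i=1}^k a_ix_{n_i}\|-\|\sum_{i=1}^k a_ie_i\|_S\,\big|\le\varepsilon$ for all $\ell\le n_1<\ldots<n_k$ and all $a_1,\ldots,a_k\in[-1,1]$. *)

(* Defs.v *)
From mathcomp Require Import all_boot all_order all_algebra.
From mathcomp Require Import all_classical all_reals all_analysis.

Set Implicit Arguments.
Unset Strict Implicit.
Unset Printing Implicit Defensive.

Import Order.TTheory GRing.Theory Num.Theory.
Import numFieldNormedType.Exports.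

Local Open Scope classical_set_scope.
Local Open Scope ring_scope.

Section weak_convergence.
Context {R : realType}.

Definition weakly_cvg (X : normedModType R) (x : nat -> X) (l : X) : Prop :=
  forall phi : {linear X -> R^o}, continuous phi ->
    phi (x n) @[n --> \oo] --> phi l.

Definition weakly_sequentially_continuous (X Y : normedModType R)
    (f : X -> Y) : Prop :=
  forall (x : nat -> X) (l : X), weakly_cvg x l -> weakly_cvg (f \o x) (f l).

End weak_convergence.

Section coarse_maps.
Context {R : realType} (X Y : normedModType R).

Definition expansion_modulus (f : X -> Y) (t : R) : \bar R :=
  ereal_sup [set `|f p.1 - f p.2|%:E | p in [set p : X * X | `|p.1 - p.2| <= t]].

Definition coarse (f : X -> Y) : Prop :=
  forall t : R, 0 <= t -> (expansion_modulus f t < +oo)%E.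

Definition compression_modulus (f : X -> Y) (alpha beta : R) : \bar R :=
  ereal_inf [set `|f p.1 - f p.2|%:E |
    p in [set p : X * X | alpha <= `|p.1 - p.2| <= beta]].

Definition property_star (f : X -> Y) : Prop :=
  exists alpha beta : R, [/\ 0 < alpha, alpha < beta &
    (0 < compression_modulus f alpha beta)%E].

End coarse_maps.

Section asymptotic_uniform_convexity.
Context {R : realType} (Y : normedModType R).

Definition finite_codim (E : set Y) : Prop :=
  exists (d : nat) (v : 'I_d -> Y), forall y : Y,
    exists a : 'I_d -> R, E (y - \sum_(i < d) a i *: v i).

Definition cof : set (set Y) :=
  [set E : set Y | [/\ submod_closed [in E], closed E & finite_codim E]].

Definition unit_sphere (E : set Y) : set Y := [set y | E y /\ `|y| = 1].

(* The infima and suprema are taken in the extended reals, so that the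
   infimum over an empty sphere (E = 0, for Y finite-dimensional) is +oo. *)
Definition auc_modulus (t : R) : \bar R :=
  (ereal_inf [set ereal_sup [set ereal_inf
     [set `|x + t *: y|%R%:E | y in unit_sphere E] | E in cof]
     | x in unit_sphere [set: Y]] - 1)%E.

Definition auc_norm_sum (k : nat) : \bar R :=
  ereal_inf [set lambda%:E | lambda in [set lambda : R |
    0 < lambda /\ (k%:R%:E * auc_modulus lambda^-1 <= 1)%E]].

End asymptotic_uniform_convexity.

Section spreading_models.
Context {R : realType} (X S : normedModType R).

Definition no_cauchy_subsequence (x : nat -> X) : Prop :=
  forall s : nat -> nat, {homo s : i j / (i < j)%N} ->
    ~ cauchy (x (s n) @[n --> \oo]).

(* Sequences are indexed from 0: e 0, ..., e k.-1 are the vectors written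
   e_1, ..., e_k in the usual notation. *)
Definition is_spreading_model (x : nat -> X) (e : nat -> S) : Prop :=
  [/\ bounded_fun x, no_cauchy_subsequence x &
    forall (eps : R) (k : nat), 0 < eps -> exists l : nat,
      forall (n : 'I_k -> nat) (a : 'I_k -> R),
        (forall i, (l <= n i)%N) ->
        {homo n : i j / (i < j)%N} ->
        (forall i, -1 <= a i <= 1) ->
        `| `|\sum_(i < k) a i *: x (n i)| - `|\sum_(i < k) a i *: e i| |
          <= eps].

End spreading_models.

(* Main.v *)
(* Let [b = f (- a x_0)], where [a] and [gamma] come from Property (star), and add
   the vectors [a x_n] to [z = 0] one at a time, [n] being chosen large each time.
   By weak continuity the increments [u_n = f (z + a x_n) - f z] are weakly null of
   norm at least [gamma], hence almost lie in any given closed subspace of finite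
   codimension. If [lambda > 0] satisfies [k * delta (1 / lambda) > 1], where [delta]
   is the modulus of [Y], then, since [delta t / t] is nondecreasing, each step increases
   [|f z - b|] by at least [gamma * lambda / (2 k)] while this distance is below
   [gamma * lambda / 2], and weak lower semicontinuity of the norm prevents it
   from dropping afterwards. After [k] steps the distance exceeds
   [gamma * lambda / 4], whereas it is at most affine in the norm of the sum of the
   chosen [x_n], [f] being coarse. That norm is close to the norm of
   [e_1 + ... + e_k], itself bounded below because [x] is normalized and weakly null. *)
From HB Require Import structures.
Require Import Defs.
From mathcomp Require Import all_boot all_order all_algebra.
From mathcomp Require Import all_classical all_reals all_analysis.
From mathcomp Require Import ring lra.

Import Order.TTheory GRing.Theory Num.Theory.
Import numFieldNormedType.Exports.

Local Open Scope classical_set_scope.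
Local Open Scope ring_scope.

(** * Hahn-Banach theorem *)

Section hahn_banach.
Context {R : realType} {V : lmodType R}.
Implicit Types (p q : V -> R) (x y z : V).

Definition sublinear q :=
  (forall x y, q (x + y) <= q x + q y) /\
  (forall (t : R) x, 0 <= t -> q (t *: x) = t * q x).

Lemma sublinear0 q : sublinear q -> q 0 = 0.
Proof. by case=> _ qZ; rewrite -(scale0r 0) qZ// mul0r. Qed.

Lemma sublinear_geN q x : sublinear q -> - q (- x) <= q x.
Proof.
move=> sq; rewrite -subr_ge0 opprK -(sublinear0 _ sq) -[in leLHS](subrr x).
by case: sq => + _; exact.
Qed.

(** Suited to infima, where [<=] is the direct inequality: the reverse one for [t > 0] is the
    hypothesis for [t^-1] at [t *: x]. *)
Lemma sublinearP q : (forall x y, q (x + y) <= q x + q y) ->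
  (forall (t : R) x, 0 <= t -> q (t *: x) <= t * q x) -> sublinear q.
Proof.
move=> qD qZ; split=> // t x; rewrite le_eqVlt => /predU1P[<-|t0].
  rewrite scale0r mul0r; apply/eqP; rewrite eq_le; apply/andP; split.
    by have := qZ 0 0 (lexx 0); rewrite scale0r mul0r.
  by have := qD 0 0; rewrite addr0; lra.
apply/eqP; rewrite eq_le (qZ _ _ (ltW t0))/= -ler_pdivlMl//.
have := qZ t^-1 (t *: x); rewrite scalerA mulVf ?gt_eqF// scale1r; apply.
by rewrite invr_ge0 ltW.
Qed.

Let shifts q y x := [set q (x + t *: y) - t * q y | t in [set t : R | 0 <= t]].

(* The largest sublinear functional below [q] with value at most [- q y] at [- y]. *)
Definition flatten_along q y x : R := inf (shifts q y x).

Let shifts_ge q y x : sublinear q -> lbound (shifts q y x) (- q (- x)).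
Proof.
move=> sq _ [t /= t0 <-]; case: sq => qD qZ.
have := qD (x + t *: y) (- x); rewrite addrAC subrr add0r qZ//; lra.
Qed.

Let shifts_neq0 q y x : shifts q y x !=set0.
Proof. by exists (q (x + 0 *: y) - 0 * q y), 0 => /=. Qed.

Let flatten_ge q y x r : lbound (shifts q y x) r -> r <= flatten_along q y x.
Proof. exact: lb_le_inf. Qed.

Let flatten_leq q y x t : sublinear q -> 0 <= t ->
  flatten_along q y x <= q (x + t *: y) - t * q y.
Proof.
move=> sq t0; apply: ge_inf; last by exists t.
by exists (- q (- x)); exact: shifts_ge.
Qed.

Lemma flatten_along_le q y x : sublinear q -> flatten_along q y x <= q x.
Proof.
by move=> sq; have := flatten_leq q y x 0 sq (lexx 0); rewrite scale0r addr0 mul0r subr0.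
Qed.

Lemma flatten_alongN q y : sublinear q -> flatten_along q y (- y) <= - q y.
Proof.
move=> sq; have := flatten_leq q y (- y) 1 sq ler01.
by rewrite scale1r addNr sublinear0// mul1r sub0r.
Qed.

Lemma flatten_along_sublinear q y : sublinear q -> sublinear (flatten_along q y).
Proof.
move=> sq; have [qD qZ] := sq; apply: sublinearP.
  move=> x z; rewrite -lerBlDr; apply: flatten_ge => _ [s /= s0 <-].
  rewrite lerBlDr -lerBlDl; apply: flatten_ge => _ [t /= t0 <-].
  rewrite lerBlDl.
  have := flatten_leq q y (x + z) (s + t) sq (addr_ge0 s0 t0).
  have := qD (x + s *: y) (z + t *: y).
  rewrite addrACA -scalerDl; lra.
move=> t x; rewrite le_eqVlt => /predU1P[<-|t0].
  by rewrite scale0r mul0r (le_trans (flatten_along_le _ _ _ sq))// sublinear0.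
rewrite -ler_pdivrMl//; apply: flatten_ge => _ [s /= s0 <-].
rewrite ler_pdivrMl//.
have := flatten_leq q y (t *: x) (t * s) sq (mulr_ge0 (ltW t0) s0).
by rewrite -scalerA -scalerDr (qZ _ _ (ltW t0)) mulrBr mulrA.
Qed.

(** Zorn's lemma: the pointwise infimum of a nonempty chain is a lower bound of it, finite because
    [q x >= - q (- x) >= - p (- x)]. *)
Lemma exists_minimal_sublinear p : sublinear p -> exists q,
  [/\ sublinear q, forall x, q x <= p x &
    forall r, sublinear r -> (forall x, r x <= q x) -> forall x, q x <= r x].
Proof.
move=> sp; pose below q := sublinear q /\ forall x, q x <= p x; pose T := {q | below q}.
(* The order is reversed, so that a maximal element is a minimal functional. *)
pose le (q r : T) := `[< forall x, sval r x <= sval q x >].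
have p_in : below p by split.
have [||A totA|[q [sq qp]] qmax] := ZL_preorder (exist below p p_in) (R := le).
- by move=> q; apply/asboolP.
- move=> q r s /asboolP qr /asboolP rs; apply/asboolP => x.
  exact: le_trans (rs x) (qr x).
- have [->|/set0P[q0 Aq0]] := eqVneq A set0.
    by exists (exist below p p_in).
  pose vals x := [set sval q x | q in A].
  have vals_lb x : lbound (vals x) (- p (- x)).
    move=> _ [[q [sq qp]] _ <-] /=.
    by rewrite (le_trans _ (sublinear_geN _ x sq))// lerN2.
  have infle (q : T) x : A q -> inf (vals x) <= sval q x.
    by move=> Aq; apply: ge_inf; [exists (- p (- x)) | exists q].
  have leinf r x : (forall q : T, A q -> r <= sval q x) -> r <= inf (vals x).
    move=> rA; apply: lb_le_inf; first by exists (sval q0 x), q0.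
    by move=> _ [q Aq <-]; exact: rA.
  have sinf : sublinear (fun x => inf (vals x)).
    apply: sublinearP => [x y|t x].
      rewrite -lerBlDr; apply: (leinf) => q Aq.
      rewrite lerBlDr -lerBlDl; apply: (leinf) => r Ar; rewrite lerBlDl.
      (* Since [A] is a chain, one of [q] and [r] lies below the other; its value at [x + y] is at
         most [q x + r y]. *)
      have [/asboolP rq|/asboolP qr] := totA _ _ Aq Ar.
        apply: le_trans (infle r _ Ar) _.
        case: r rq {Ar} => r [[rD _] _] /= rq.
        by rewrite (le_trans (rD _ _))// lerD2r.
      apply: le_trans (infle q _ Aq) _.
      case: q qr {Aq} => q [[qD _] _] /= qr.
      by rewrite (le_trans (qD _ _))// lerD2l.
    rewrite le_eqVlt => /predU1P[<-|t0].
      rewrite mul0r (le_trans (infle _ _ Aq0))// scale0r.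
      by case: q0 {Aq0} => q [sq _] /=; rewrite sublinear0.
    rewrite -ler_pdivrMl//; apply: (leinf) => q Aq; rewrite ler_pdivrMl//.
    rewrite (le_trans (infle _ _ Aq))//.
    by case: q {Aq} => q [[_ qZ] _] /=; rewrite (qZ _ _ (ltW t0)).
  have infp x : inf (vals x) <= p x.
    by rewrite (le_trans (infle _ _ Aq0))//; case: q0 {Aq0} => ? [].
  exists (exist below _ (conj sinf infp)) => q Aq; apply/asboolP => x /=.
  exact: infle.
- exists q; split=> // r sr rq x.
  have rp y : r y <= p y by exact: le_trans (rq y) (qp y).
  have /asboolP := qmax (exist below r (conj sr rp)) (asboolT rq).
  exact.
Qed.

(* A minimal sublinear functional [q] equals [flatten_along q y] for every [y],
   hence is odd, hence linear. *)
Theorem hahn_banach p (x0 : V) : sublinear p ->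
  exists phi : {linear V -> R^o}, (forall x, phi x <= p x) /\ phi x0 = p x0.
Proof.
move=> sp.
have [q [sq qp qmin]] := exists_minimal_sublinear _ (flatten_along_sublinear p x0 sp).
have [qD qZ] := sq.
have qN y : q (- y) = - q y.
  apply/eqP; rewrite eq_le; apply/andP; split.
    apply: le_trans (flatten_alongN q y sq).
    apply: qmin => [|x]; first exact: flatten_along_sublinear.
    exact: flatten_along_le.
  by rewrite lerNl; exact: sublinear_geN.
have qlin : linear (q : V -> R^o).
  have qadd x y : q (x + y) = q x + q y.
    apply/eqP; rewrite eq_le qD /=.
    have := qD (x + y) (- y); rewrite addrK qN; lra.
  move=> t x y; rewrite qadd; congr (_ + _).
  have [t0|/ltW t0] := leP 0 t; first exact: qZ.
  by rewrite -[t *: x]opprK -scaleNr qN qZ ?oppr_ge0// mulNr opprK.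
pose phiL := GRing.isLinear.Build R V R^o *:%R q qlin.
pose phi : {linear V -> R^o} := HB.pack q phiL.
have phip x : phi x <= p x.
  by rewrite (le_trans (qp x))// flatten_along_le.
exists phi; split=> //; apply/eqP; rewrite eq_le phip/=.
have /= := le_trans (qp (- x0)) (flatten_alongN p x0 sp).
by rewrite qN lerN2.
Qed.

End hahn_banach.

(** * Weakly null sequences *)

Section functionals.
Context {R : realType} {V : normedModType R}.
Implicit Types (E : set V) (x y z : V) (phi : {linear V -> R^o}).

Lemma norm_dominated_continuous phi : (forall x, `|phi x| <= `|x|) -> continuous phi.
Proof.
move=> phi1; apply/linear_bounded_continuous/linear_boundedP; near=> r => x.
rewrite (le_trans (phi1 x))// -[leLHS]mul1r.
apply: ler_wpM2r; first exact: normr_ge0.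
by near: r; exact: nbhs_pinfty_ge.
Unshelve. all: by end_near. Qed.

Lemma le_linear_norm (p : V -> R) phi : (forall x, p x <= `|x|) -> (forall x, phi x <= p x) ->
  forall x, `|phi x| <= `|x|.
Proof.
move=> p1 phip x; rewrite ler_norml lerNl -linearN/= -{1}(normrN x).
by rewrite !(le_trans (phip _)).
Qed.

Lemma norming_functional x0 : exists phi,
  [/\ continuous phi, forall x, `|phi x| <= `|x| & phi x0 = `|x0|].
Proof.
have sN : sublinear (fun x => `|x|).
  by split=> [x y|t x t0]; [exact: ler_normD | rewrite normrZ ger0_norm].
have [phi [phi1 phix0]] := hahn_banach _ x0 sN.
have phiN := le_linear_norm _ phi (fun=> lexx _) phi1.
by exists phi; split=> //; exact: norm_dominated_continuous.
Qed.

Lemma submod_closedP E : submod_closed [in E] <->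
  E 0 /\ forall (a : R) x y, E x -> E y -> E (a *: x + y).
Proof.
split=> [[E0 EZD]|[E0 EZD]]; split=> [|a x y].
- exact: set_mem.
- by move=> Ex Ey; apply: set_mem; apply: EZD; exact: mem_set.
- exact: mem_set.
- by move=> /set_mem Ex /set_mem Ey; apply/mem_set/EZD.
Qed.

Let dists E x := [set `|x - w| | w in E].

Let dists_ge0 E x : lbound (dists E x) 0.
Proof. by move=> _ [w _ <-]. Qed.

Let dist E x := inf (dists E x).

Let dist_le E x w : E w -> dist E x <= `|x - w|.
Proof. by move=> Ew; apply: ge_inf; [exists 0; exact: dists_ge0|exists w]. Qed.

Let le_dist E x r : submod_closed [in E] -> (forall w, E w -> r <= `|x - w|) ->
  r <= dist E x.
Proof.
move=> /submod_closedP[E0 _] Er; apply: lb_le_inf; first by exists `|x - 0|, 0.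
by move=> _ [w Ew <-]; exact: Er.
Qed.

Let dist_sublinear E : submod_closed [in E] -> sublinear (dist E).
Proof.
move=> sE; have /submod_closedP[E0 EZD] := sE; apply: sublinearP => [x y|t x].
  rewrite -lerBlDr; apply: le_dist => // w Ew.
  rewrite lerBlDr -lerBlDl; apply: le_dist => // z Ez; rewrite lerBlDl.
  have Ewz : E (w + z) by rewrite -[w]scale1r; exact: EZD.
  rewrite (le_trans (dist_le E (x + y) _ Ewz))//.
  by rewrite opprD addrACA; exact: ler_normD.
rewrite le_eqVlt => /predU1P[<-|t0].
  by rewrite scale0r mul0r (le_trans (dist_le E 0 _ E0))// subrr normr0.
rewrite -ler_pdivrMl//; apply: le_dist => // w Ew; rewrite ler_pdivrMl//.
have Etw : E (t *: w) by rewrite -[_ *: _]addr0; exact: EZD.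
rewrite (le_trans (dist_le E (t *: x) _ Etw))//.
by rewrite -scalerBr normrZ gtr0_norm.
Qed.

Let dist_gt0 E x : submod_closed [in E] -> closed E -> ~ E x -> 0 < dist E x.
Proof.
move=> sE cE nEx.
have /nbhs_ballP[e /= e0 xe] : nbhs x (~` E).
  by apply: open_nbhs_nbhs; split=> //; exact: closed_openC.
apply: (lt_le_trans e0); apply: le_dist => // w Ew; rewrite leNgt; apply/negP => xw.
by apply: (xe w) => //; rewrite -ball_normE.
Qed.

(** Hahn-Banach for the distance to [E], which is sublinear, at most the norm, zero on [E], and
    positive at [v] because [E] is closed. *)
Lemma separating_functional E v : submod_closed [in E] -> closed E -> ~ E v ->
  exists phi, [/\ forall x, `|phi x| <= `|x|, forall w, E w -> phi w = 0 & phi v != 0].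
Proof.
move=> sE cE nEv; have [phi [phi1 phiv]] := hahn_banach _ v (dist_sublinear E sE).
have /submod_closedP[E0 EZD] := sE.
have dist0 w : E w -> dist E w <= 0.
  by move=> Ew; rewrite (le_trans (dist_le E w _ Ew))// subrr normr0.
exists phi; split=> [|w Ew|].
- apply: (le_linear_norm (dist E)) => // x.
  by rewrite (le_trans (dist_le E x _ E0))// subr0.
- apply/eqP; rewrite eq_le (le_trans (phi1 w) (dist0 _ Ew))/=.
  rewrite -oppr_le0 -linearN (le_trans (phi1 _))// dist0//.
  by rewrite -scaleN1r -[_ *: _]addr0; exact: EZD.
- by rewrite phiv gt_eqF// dist_gt0.
Qed.

(** Weak lower semicontinuity of the norm: a norming functional [phi] of [y] gives
    [|y + u n| >= |y| + phi (u n)], and [phi (u n)] tends to [0]. *)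
Lemma weakly_null_norm_gt (y : V) (u : nat -> V) (c : R) : weakly_cvg u 0 ->
  c < `|y| -> \forall n \near \oo, c < `|y + u n|.
Proof.
move=> u0 cy; have [phi [cphi phi1 phiy]] := norming_functional y.
have := u0 phi cphi; rewrite linear0 => phiu.
near=> n; have un : `|phi (u n)| < `|y| - c.
  by near: n; apply: (cvgr0_norm_lt _ phiu); rewrite subr_gt0.
rewrite (lt_le_trans _ (phi1 _))// (lt_le_trans _ (ler_norm _))//.
rewrite linearD phiy/=; move: un; rewrite ltr_norml; lra.
Unshelve. all: by end_near. Qed.

(* If [v] is the first of the vectors spanning [V] modulo [E], either [v] lies in [E],
   or [E + R v] is the closed subspace [[set z | E (proj z)]] below. *)
Lemma weakly_null_near_closed_finite_codim E (u : nat -> V) (eps : R) :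
  cof E -> weakly_cvg u 0 -> 0 < eps ->
  \forall n \near \oo, exists2 w, E w & `|u n - w| < eps.
Proof.
move=> [sE cE [d [v Ev]]] u0; elim: d => [|d IHd] in E sE cE v Ev eps *.
  move=> eps0; near=> n; exists (u n); last by rewrite subrr normr0.
  by have [a] := Ev (u n); rewrite big_ord0 subr0.
have /submod_closedP[E0 EZD] := sE.
have [Ev0|nEv0] := pselect (E (v ord0)).
  apply: (IHd E sE cE (v \o lift ord0)) => y.
  have [a Ea] := Ev y; exists (a \o lift ord0).
  have := EZD (a ord0) _ _ Ev0 Ea; rewrite big_ord_recl opprD.
  by rewrite addrCA addNKr.
have [phi [phi1 phiE phiv]] := separating_functional E _ sE cE nEv0.
pose proj z := z - (phi z / phi (v ord0)) *: v ord0.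
have projZD (a : R) x y : proj (a *: x + y) = a *: proj x + proj y.
  rewrite /proj linearP/= mulrDl scalerDl -mulrA -scalerA.
  by rewrite scalerBr opprD addrACA.
pose F := [set z | E (proj z)].
have sF : submod_closed [in F].
  apply/submod_closedP; split=> [|a x y Fx Fy].
    by rewrite /F/= /proj linear0 mul0r scale0r subr0.
  by rewrite /F/= projZD; exact: EZD.
have cphi := norm_dominated_continuous phi phi1.
have cF : closed F.
  apply: closed_comp => // z _; apply: cvgB; first exact: cvg_id.
  by apply: cvgZr_tmp; apply: cvgMr_tmp; exact: cphi.
have Fv y : exists a : 'I_d -> R, F (y - \sum_(i < d) a i *: (v \o lift ord0) i).
  have [a Ea] := Ev y; exists (a \o lift ord0); move: Ea; rewrite /F/=.
  rewrite big_ord_recl opprD addrA => Ea.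
  set r := y - _ - _ in Ea.
  have -> : y - \sum_(i < d) a (lift ord0 i) *: v (lift ord0 i) =
      a ord0 *: v ord0 + r.
    by rewrite /r -addrA addrCA addNKr.
  rewrite projZD {1}/proj divff// scale1r subrr scaler0 add0r.
  by rewrite /proj (phiE _ Ea) mul0r scale0r subr0.
move=> eps0; pose K := `|v ord0| / `|phi (v ord0)|.
have K0 : 0 <= K by rewrite divr_ge0.
(* Passing from [w] to [proj w] costs [|phi w| * K], where [|phi w| <= |phi (u n)| + |u n - w| <= 2
   * e]; the total [e + 2 * e * K] is less than [eps]. *)
pose e := eps / (2 * (1 + K)).
have e0 : 0 < e by rewrite divr_gt0// mulr_gt0// ltr_wpDr.
have := u0 phi cphi; rewrite linear0 => phiu.
near=> n.
have [w Fw uw] : exists2 w, F w & `|u n - w| < e.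
  by near: n; exact: (IHd F sF cF _ Fv e e0).
have phiun : `|phi (u n)| < e by near: n; exact: (cvgr0_norm_lt _ phiu).
exists (proj w) => //.
have -> : u n - proj w = (u n - w) + (phi w / phi (v ord0)) *: v ord0.
  by rewrite /proj opprB addrA addrAC.
have phiw : `|phi w| <= e + e.
  rewrite -[w](subKr (u n)) linearB/= (le_trans (ler_normB _ _))//.
  by rewrite lerD// ?ltW// (le_lt_trans (phi1 _)).
have : `|phi w| * K <= (e + e) * K by rewrite ler_wpM2r.
have -> : eps = 2 * e * (1 + K).
  by rewrite /e mulrAC mulrC divfK// gt_eqF// mulr_gt0// ltr_wpDr.
have := ler_normD (u n - w) ((phi w / phi (v ord0)) *: v ord0).
have -> : `|(phi w / phi (v ord0)) *: v ord0| = `|phi w| * K.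
  by rewrite normrZ normf_div mulrAC -mulrA.
lra.
Unshelve. all: by end_near. Qed.

End functionals.

(** * Asymptotic uniform convexity and coarse maps *)

Section nonlinear.
Context {R : realType}.

(* With [a = |y| / (lambda |w|) <= 1], the vector [y + a w] is both
   [|y| (x + lambda^-1 v)], for the normalizations [x] of [y] and [v] of [w], and the
   convex combination [(1 - a) y + a (y + w)]. *)
Lemma norm_growth_of_normalized (Y : normedModType R) (y w : Y) (lambda g d : R) :
  0 < lambda -> 0 < g -> 0 <= d -> y != 0 -> `|y| <= g * lambda -> g <= `|w| ->
  1 + d <= `| `|y|^-1 *: y + lambda^-1 *: (`|w|^-1 *: w)| ->
  `|y| + g * lambda * d <= `|y + w|.
Proof.
move=> l0 g0 d0 yN0 yM gw h.
have y0 : 0 < `|y| by rewrite normr_gt0.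
have w0 : 0 < `|w| by exact: lt_le_trans gw.
pose a := `|y| / (lambda * `|w|).
have a0 : 0 < a by rewrite divr_gt0// mulr_gt0.
have a1 : a <= 1.
  rewrite ler_pdivrMr ?mulr_gt0// mul1r (le_trans yM)// mulrC.
  by rewrite ler_wpM2l// ltW.
have yE : `|y| = a * (lambda * `|w|) by rewrite divfK// mulf_neq0 ?gt_eqF.
have {}h : `|y| * (1 + d) <= `|y + a *: w|.
  have -> : y + a *: w =
      `|y| *: (`|y|^-1 *: y + lambda^-1 *: (`|w|^-1 *: w)).
    rewrite scalerDr !scalerA divff ?gt_eqF// scale1r.
    by rewrite /a invfM mulrA.
  by rewrite normrZ normr_id ler_wpM2l.
move: a a0 a1 yE h => a a0 a1 yE h.
have : `|y + a *: w| <= (1 - a) * `|y| + a * `|y + w|.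
  have -> : y + a *: w = (1 - a) *: y + a *: (y + w).
    by rewrite scalerDr addrA -scalerDl subrK scale1r.
  rewrite (le_trans (ler_normD _ _))// !normrZ.
  by rewrite (ger0_norm (ltW a0)) ger0_norm ?subr_ge0.
move=> /(le_trans h) {}h.
have {}h : a * (`|y| + lambda * `|w| * d) <= a * `|y + w|.
  have -> : a * (`|y| + lambda * `|w| * d) = `|y| * (1 + d) - (1 - a) * `|y|.
    by rewrite mulrDr mulrA -yE; ring.
  by rewrite lerBlDl.
rewrite ler_pM2l// in h; apply: le_trans h; rewrite lerD2l.
by rewrite ler_wpM2r// mulrC ler_wpM2l// ltW.
Qed.

(** The modulus at the normalized [y] provides a subspace [E], and [u n] is replaced by a nearby [w]
    in [E]; the bound [2 * g] instead of [g] leaves room for this. *)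
Lemma weakly_null_norm_growth (Y : normedModType R) (y : Y) (u : nat -> Y)
    (lambda g d : R) :
  0 < lambda -> 0 < g -> 0 <= d -> (d%:E < auc_modulus Y lambda^-1)%E ->
  y != 0 -> `|y| <= g * lambda -> weakly_cvg u 0 -> (forall n, 2 * g <= `|u n|) ->
  \forall n \near \oo, `|y| + g * lambda * d <= `|y + u n|.
Proof.
move=> l0 g0 d0 dauc yN0 yM u0 gu.
pose x := `|y|^-1 *: y.
have x1 : unit_sphere [set: Y] x.
  by split=> //; rewrite normrZ normfV normr_id mulVf// normr_eq0.
move: dauc; rewrite /auc_modulus lteBrDr//.
move=> /lt_le_trans/(_ (ereal_inf_lbound _)) => /(_ _ (imageP _ x1)).
move=> /ereal_sup_gt[_ [E cE <-]] dE.
have [d' dd' Ed'] : exists2 d', d < d' & forall v, unit_sphere E v ->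
    1 + d' <= `|x + lambda^-1 *: v|.
  have lbE v : unit_sphere E v -> (ereal_inf
      [set `|x + lambda^-1 *: v|%:E | v in unit_sphere E] <=
      `|x + lambda^-1 *: v|%:E)%E.
    by move=> Ev; apply: ereal_inf_lbound; exists v.
  (* The infimum is [+oo] only if the sphere of [E] is empty, and then any [d'] serves. *)
  case: ereal_inf dE lbE => [r||//] dE lbE.
  - exists (r - 1); first by rewrite -EFinD lte_fin in dE; lra.
    by move=> v /lbE; rewrite lee_fin subrKC.
  - by exists (d + 1) => [|v /lbE//]; rewrite ltrDl.
have d'0 : 0 <= d' by rewrite ltW// (le_lt_trans d0).
have M0 : 0 < g * lambda by rewrite mulr_gt0.
(* The first entry ensures [|w| >= g]; the second is the surplus growth obtained from [d'] over that
   required by [d]. *)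
pose eps := Num.min g (g * lambda * (d' - d)).
have eps0 : 0 < eps by rewrite lt_min g0 mulr_gt0// subr_gt0.
apply: filterS (weakly_null_near_closed_finite_codim _ _ _ cE u0 eps0).
move=> n [w Ew uw]; move: uw; rewrite lt_min => /andP[uw1 uw2].
have gw : g <= `|w|.
  have := gu n; have := ler_normD (u n - w) w; rewrite subrK; lra.
have w0 : 0 < `|w| by exact: lt_le_trans gw.
have [sE _ _] := cE; have /submod_closedP[E0 EZD] := sE.
have Ew1 : unit_sphere E (`|w|^-1 *: w).
  split; first by rewrite -[_ *: _]addr0; exact: EZD.
  by rewrite normrZ normfV normr_id mulVf// gt_eqF.
have := norm_growth_of_normalized _ _ _ _ _ _ l0 g0 d'0 yN0 yM gw (Ed' _ Ew1).
have -> : y + w = (y + u n) - (u n - w) by rewrite opprB addrCA addrK addrC.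
have := ler_normB (y + u n) (u n - w); lra.
Qed.

(** A segment of length at most [n] splits into [n] pieces of length at most [1], on each of which
    [f] moves by at most [L]; take for [n] the integer part of [|x - y|] plus one. *)
Lemma coarse_affine_bound (X Y : normedModType R) (f : X -> Y) : coarse f ->
  exists2 L : R, 0 < L & forall x y, `|f x - f y| <= L * (`|x - y| + 1).
Proof.
move=> /(_ 1 ler01); rewrite /expansion_modulus; set A := [set _ | p in _] => supA.
have [L L0 fL] : exists2 L : R, 0 < L & forall x y, `|x - y| <= 1 -> `|f x - f y| <= L.
  have ubA x y : `|x - y| <= 1 -> (`|f x - f y|%:E <= ereal_sup A)%E.
    by move=> xy; apply: ereal_sup_ubound; exists (x, y).
  case: (ereal_sup A) supA ubA => [r _|//|_] ubA.
  - exists (`|r| + 1); first by rewrite ltr_wpDl.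
    move=> x y /ubA; rewrite lee_fin => /le_trans; apply.
    by rewrite (le_trans (ler_norm r))// lerDl.
  - by have := ubA 0 0; rewrite subrr normr0 ler01 => /(_ isT).
have fLn n x y : `|x - y| <= n%:R -> `|f x - f y| <= L * n%:R.
  elim: n x y => [|n IHn] x y xy.
    move: xy; rewrite normr_le0 subr_eq0 => /eqP ->.
    by rewrite subrr normr0 mulr0.
  (* Cuts off one of [n.+1] equal pieces, the one at [x]. *)
  pose z := y + (n%:R / n.+1%:R) *: (x - y).
  have -> : f x - f y = (f x - f z) + (f z - f y) by rewrite addrA subrK.
  rewrite (le_trans (ler_normD _ _))// -natr1 mulrDr mulr1 addrC lerD//.
    apply: IHn; rewrite /z addrAC subrr add0r normrZ ger0_norm ?divr_ge0//.
    by rewrite mulrAC ler_pdivrMr// ler_wpM2l.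
  apply: fL.
  have -> : x - z = n.+1%:R^-1 *: (x - y).
    rewrite /z opprD addrA -{1}[x - y]scale1r -scalerBl; congr (_ *: _).
    by apply/eqP; rewrite subr_eq -{1}[_^-1]mul1r -mulrDl addrC natr1 divff.
  by rewrite normrZ ger0_norm ?invr_ge0// mulrC ler_pdivrMr// mul1r.
exists L => // x y.
have /andP[le_xy lt_xy] := truncn_itv (normr_ge0 (x - y)).
rewrite (le_trans (fLn _ _ _ (ltW lt_xy)))// ler_pM2l// -natr1.
by rewrite lerD2r.
Qed.

Lemma property_star_lower_bound (X Y : normedModType R) (f : X -> Y) :
  property_star f -> exists a g : R, [/\ 0 < a, 0 < g &
    forall x y, `|x - y| = a -> g <= `|f x - f y|].
Proof.
move=> [a [b [a0 ab]]]; rewrite /compression_modulus.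
set A := [set _ | p in _] => infA.
have lbA x y : `|x - y| = a -> (ereal_inf A <= `|f x - f y|%:E)%E.
  move=> xy; apply: ereal_inf_lbound; exists (x, y) => //=.
  by rewrite xy lexx ltW.
case: (ereal_inf A) infA lbA => [r r0|_|//] lbA.
- by exists a, r; split.
(* An infinite infimum means that no two points are at distance [a]. *)
- by exists a, 1; split=> // x y /lbA.
Qed.

(** Runs the inductive choices: [Q] is an invariant of the partial sums, and each new index is taken
    beyond [l], beyond the earlier indices, and large enough to preserve [Q]. *)
Lemma select_increasing (V : zmodType) (Q : nat -> V -> Prop) (x : nat -> V) :
  Q 0%N 0 -> (forall j z, Q j z -> \forall n \near \oo, Q j.+1 (z + x n)) ->
  forall l k, exists n : 'I_k -> nat,
    [/\ forall i, (l <= n i)%N, {homo n : i j / (i < j)%N} &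
      Q k (\sum_(i < k) x (n i))].
Proof.
move=> Q0 QS l k.
suff [m [lm mm Qm]] : exists m : nat -> nat, [/\ forall i, (i < k)%N -> (l <= m i)%N,
    forall i j, (i < j < k)%N -> (m i < m j)%N & Q k (\sum_(i < k) x (m i))].
  exists (m \o val); split=> [i|i j ij|//]; first exact/lm/ltn_ord.
  by apply: mm; rewrite ij ltn_ord.
elim: k => [|k [m [lm mm Qm]]]; first by exists id; rewrite big_ord0; split=> // i j; rewrite ltn0 andbF.
near \oo => N.
exists (fun i => if (i < k)%N then m i else N); split.
- move=> i _; case: ifPn => [/lm//|_]; near: N; exact: nbhs_infty_ge.
- move=> i j /andP[ij]; rewrite ltnS leq_eqVlt => /predU1P[jk|jk].
    rewrite jk ltnn -jk ij.
    have : (\max_(i < k) m i < N)%N by near: N; exact: nbhs_infty_gt.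
    apply: leq_trans; rewrite ltnS; rewrite jk in ij.
    exact: (leq_bigmax (Ordinal ij)).
  by rewrite jk (ltn_trans ij jk) mm// ij.
- rewrite big_ord_recr/= ltnn.
  under eq_bigr do rewrite ltn_ord.
  by near: N; exact: QS.
Unshelve. all: by end_near. Qed.

Lemma weakly_cvgZD (X : normedModType R) (x : nat -> X) (a : R) (z : X) :
  weakly_cvg x 0 -> weakly_cvg (fun n => z + a *: x n) z.
Proof.
move=> x0 phi cphi; rewrite -[phi z]addr0 -(mulr0 a) -[X in a * X](linear0 phi).
rewrite [X in X @ _ --> _](_ : _ = fun n => phi z + a * phi (x n)); last first.
  by apply/funext => n; rewrite linearD linearZ.
by apply: cvgD; [exact: cvg_cst | apply: cvgMl_tmp; exact: x0].
Qed.

Lemma weakly_cvgB_cst (Y : normedModType R) (y : nat -> Y) (l : Y) :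
  weakly_cvg y l -> weakly_cvg (fun n => y n - l) 0.
Proof.
move=> yl phi cphi; rewrite linear0 -(subrr (phi l)).
rewrite [X in X @ _ --> _](_ : _ = fun n => phi (y n) - phi l); last first.
  by apply/funext => n; rewrite linearB.
by apply: cvgB; [exact: yl | exact: cvg_cst].
Qed.

Lemma spreading_model_norm_sum (X S : normedModType R) (x : nat -> X)
    (e : nat -> S) (eps : R) (k : nat) : is_spreading_model x e -> 0 < eps ->
  exists l : nat, forall n : 'I_k -> nat, (forall i, (l <= n i)%N) ->
    {homo n : i j / (i < j)%N} ->
    `| `|\sum_(i < k) x (n i)| - `|\sum_(i < k) e i| | <= eps.
Proof.
move=> [_ _ xe] eps0; have [l le] := xe eps k eps0.
exists l => n ln nn; have /= := le n (fun=> 1) ln nn.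
under eq_bigr do rewrite scale1r.
under [X in _ - `|X|]eq_bigr do rewrite scale1r.
by apply=> _; rewrite lexx andbT; lra.
Qed.

(** Sums started at a unit vector keep norm above [3 / 4] by weak lower semicontinuity, and the
    spreading model is approximated within [1 / 4]. *)
Lemma spreading_model_norm_sum_ge (X S : normedModType R) (x : nat -> X)
    (e : nat -> S) (k : nat) :
  (forall n, `|x n| = 1) -> weakly_cvg x 0 -> is_spreading_model x e -> (0 < k)%N ->
  2^-1 <= `|\sum_(i < k) e i|.
Proof.
move=> x1 x0 xe k0.
have e0 : 0 < 4^-1 :> R by rewrite invr_gt0.
have [l le] := spreading_model_norm_sum _ _ _ _ _ k xe e0.
pose Q j (z : X) := if j is 0 then z = 0 else 3 / 4 < `|z|.
have Q0 : Q 0%N 0 by [].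
have QS j z : Q j z -> \forall n \near \oo, Q j.+1 (z + x n).
  case: j => [->|j Qz] /=; last exact: weakly_null_norm_gt.
  by apply: nearW => n; rewrite add0r x1; lra.
case: k k0 le => // k _ le.
have [n [ln nn /= Qn]] := select_increasing _ _ _ Q0 QS l k.+1.
by have := le n ln nn; rewrite ler_norml; lra.
Qed.

End nonlinear.

(* The images [f (a (x_{n_1} + ... + x_{n_j}))] move away from [f (- a x_0)] by at least
   [g * lambda / k] at each step, as long as their distance to it is below [g * lambda]. *)
Lemma auc_lambda_bound (R : realType) (X Y : normedModType R) (f : X -> Y) (a g : R)
    (x : nat -> X) (lambda : R) (k l : nat) :
  weakly_sequentially_continuous f -> 0 < a -> 0 < g ->
  (forall z y, `|z - y| = a -> 2 * g <= `|f z - f y|) ->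
  (forall n, `|x n| = 1) -> weakly_cvg x 0 -> (0 < k)%N -> 0 < lambda ->
  (k%:R^-1%:E < auc_modulus Y lambda^-1)%E ->
  exists n : 'I_k -> nat, [/\ forall i, (l <= n i)%N, {homo n : i j / (i < j)%N} &
    g * lambda / 2 < `|f (a *: \sum_(i < k) x (n i)) - f (- (a *: x 0%N))|].
Proof.
move=> wf a0 g0 ga x1 x0 k0 l0 auc.
set b := f _; pose M := g * lambda.
have M0 : 0 < M by rewrite mulr_gt0.
have k0' : 0 < k%:R^-1 :> R by rewrite invr_gt0 ltr0n.
have ax z n : `|(z + a *: x n) - z| = a.
  by rewrite addrAC subrr add0r normrZ x1 mulr1 gtr0_norm.
(* The growth estimate holds only for distances up to [M]. A larger distance may shrink at the next
   step, but stays above the cap [M / 2] by weak lower semicontinuity. *)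
pose Q (j : nat) (z : X) := Num.min (j%:R * (M * k%:R^-1)) (M / 2) < `|f z - b|.
(* This is why [b] is the image of a point at distance [a] from [0]: [f 0 - b] is nonzero, so it can
   be normalized. *)
have Q0 : Q 0%N 0.
  rewrite /Q mul0r gt_min (@lt_le_trans _ _ (2 * g))//; first by rewrite mulr_gt0.
  by apply: ga; rewrite sub0r opprK normrZ x1 mulr1 gtr0_norm.
have QS j z : Q j z -> \forall n \near \oo, Q j.+1 (z + a *: x n).
  move=> Qz; pose u n := f (z + a *: x n) - f z.
  have u0 : weakly_cvg u 0 by apply/weakly_cvgB_cst/wf/weakly_cvgZD.
  have gu n : 2 * g <= `|u n| by apply: ga; exact: ax.
  have fE n : f (z + a *: x n) - b = (f z - b) + u n.
    by rewrite /u [RHS]addrC addrA subrK.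
  have Md0 : 0 < M * k%:R^-1 by rewrite mulr_gt0.
  have min0 : 0 <= Num.min (j%:R * (M * k%:R^-1)) (M / 2).
    by rewrite le_min !mulr_ge0// ltW.
  have [yM|yM] := leP `|f z - b| M; last first.
    have yM2 : M / 2 < `|f z - b| by lra.
    apply: filterS (weakly_null_norm_gt _ _ _ u0 yM2) => n.
    by rewrite /Q fE gt_min => ->; rewrite orbT.
  have yN0 : f z - b != 0 by rewrite -normr_gt0 (le_lt_trans min0).
  apply: filterS (weakly_null_norm_growth _ _ _ _ _ _ l0 g0 (ltW k0') auc yN0 yM u0 gu).
  move=> n; rewrite -/M /Q fE; apply: lt_le_trans; move: Qz; rewrite /Q !gt_min.
  by rewrite -natr1 => /orP[Qz|Qz]; apply/orP; [left | right]; lra.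
have [n [ln nn Qn]] := select_increasing _ _ _ Q0 QS l k.
exists n; split=> //; rewrite scaler_sumr.
move: Qn; rewrite /Q mulrCA divff ?mulr1; last by rewrite pnatr_eq0 -lt0n.
by rewrite gt_min => /orP[|//]; apply: lt_trans; rewrite -/M; lra.
Qed.

Theorem theorem1p3 (R : realType) (X Y : completeNormedModType R) :
  (exists f : X -> Y,
     [/\ weakly_sequentially_continuous f, coarse f & property_star f]) ->
  exists2 c : R, 0 < c &
    forall (S : completeNormedModType R) (x : nat -> X) (e : nat -> S),
      (forall n, `|x n| = 1) ->
      weakly_cvg x 0 ->
      is_spreading_model x e ->
      forall k : nat,
        (c%:E * auc_norm_sum Y k <= `|\sum_(i < k) e i|%:E)%E.
Proof.
move=> [f [wf /coarse_affine_bound[L L0 fL] /property_star_lower_bound]].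
move=> [a [g2 [a0 g20 ga]]].
pose g := g2 / 2; have g0 : 0 < g by rewrite divr_gt0.
have {}ga z y : `|z - y| = a -> 2 * g <= `|f z - f y|.
  by rewrite /g mulrC divfK//; exact: ga.
(* Since [1 <= 2 * N], one has [|s| <= N + 1 <= 3 * N] and [|a *: x 0| <= a * (2 * N)], so the
   affine bound is at most [L * (5 * a + 2) * N]; [C] makes this at most [g * lambda / 2]. *)
pose C := 2 * L * (5 * a + 2) / g.
have C0 : 0 < C by rewrite divr_gt0// !mulr_gt0// addr_gt0// mulr_gt0.
exists C^-1; first by rewrite invr_gt0.
move=> S x e x1 x0 xe k; set N := `|_|.
rewrite lee_pdivrMl// -EFinM; apply/lee_addgt0Pr => eps eps0; rewrite -EFinD.
have N0 : 0 <= N by exact: normr_ge0.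
(* The summand [eps] keeps [lambda] positive for [k = 0] as well, where [N = 0]. *)
set lambda := C * N + eps.
have l0 : 0 < lambda by rewrite ltr_wpDl// mulr_ge0// ltW.
apply: ereal_inf_lbound; exists lambda => //; split=> //.
have [->|k0] := posnP k; first by rewrite mul0e.
rewrite leNgt; apply/negP.
rewrite -lte_pdivrMl ?ltr0n// mule1 => auc.
have [l le] := spreading_model_norm_sum _ _ _ _ _ k xe ltr01.
have [n [ln nn]] := auc_lambda_bound _ _ _ _ _ _ _ _ _ l wf a0 g0 ga x1 x0 k0 l0 auc.
apply/negP; rewrite -leNgt.
have := le n ln nn; rewrite -/N ler_norml => /andP[_].
set s := \sum_(i < k) x (n i) => sN.
have N2 := spreading_model_norm_sum_ge _ _ _ _ _ x1 x0 xe k0; rewrite -/N in N2.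
rewrite (le_trans (fL _ _))//.
have h : `|a *: s - - (a *: x 0%N)| <= a * (3 * N) + a * (2 * N).
  rewrite opprK (le_trans (ler_normD _ _))// !normrZ x1 gtr0_norm//.
  by rewrite lerD// ler_pM2l//; lra.
have -> : g * lambda / 2 = L * ((5 * a + 2) * N) + g * eps / 2.
  by rewrite /lambda /C; field; rewrite gt_eqF.
have : L * (`|a *: s - - (a *: x 0%N)| + 1) <= L * ((5 * a + 2) * N).
  by rewrite ler_pM2l//; lra.
have : 0 < g * eps by rewrite mulr_gt0.
lra.
Qed.
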